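(* Let $p$ be a prime number, let $m,n$ be positive integers and let $\xi\in\mathbb{Q}_p$ be transcendental over $\mathbb{Q}$. Then $$\widehat{\lambda}_{m+n-1}(\xi)\leq \max \left\{ \frac{1}{w_{m}(\xi)},\frac{1}{\widehat{w}_{n}(\xi)}\right\}.$$
   Context: $|\cdot|_p$ is the usual $p$-adic absolute value on $\mathbb{Q}_p$, normalized by $|p|_p=p^{-1}$. For an integer $n\ge 1$ and $\xi\in\mathbb{Q}_p$, define the following extended real numbers. $w_n(\xi)$ is the supremum of the real numbers $w$ such that, for arbitrarily large real numbers $X$, the inequalities $$0<|x_n\xi^n+\cdots+x_1\xi+x_0|_p\le X^{-w-1},\qquad \max_{0\le m\le n}|x_m|\le X$$ have a solution in integers $x_0,\ldots,x_n$. $\widehat{w}_n(\xi)$ is the supremum of the real numbers $\widehat{w}$ such that, for every sufficiently large real number $X$, the inequalities $$\max\{|x_0|,\ldots,|x_n|\}\le X,\qquad 0<|x_n\xi^n+\cdots+x_1\xi+x_0|_p\le X^{-\widehat{w}-1}$$ have a solution in integers $x_0,\ldots,x_n$. $\widehat{\lambda}_n(\xi)$ is the supremum of the real numbers $\widehat{\lambda}$ such that, for every sufficiently large real number $X$, the inequalities $$\max\{|x_0|,\ldots,|x_n|\}\le X,\qquad 0<\max_{1\le m\le n}|x_0\xi^m-x_m|_p\le X^{-\widehat{\lambda}-1}$$ have a solution in integers $x_0,\ldots,x_n$. The convention $1/(+\infty)=0$ is used. *)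

(* Defs.v *)
From HB Require Import structures.
From mathcomp Require Import all_boot all_order all_algebra.
From mathcomp Require Import all_classical all_reals all_analysis.

Set Implicit Arguments.
Unset Strict Implicit.
Unset Printing Implicit Defensive.

Import Order.TTheory GRing.Theory Num.Theory.
Import numFieldNormedType.Exports.

Local Open Scope ring_scope.
Local Open Scope quotient_scope.

(* The normalization |p|_p = 1/p, i.e. |q|_p = p^(v_p(den q) - v_p(num q)). *)

Definition rat_padic_abs (p : nat) (q : rat) : rat :=
  if q == 0 then 0
  else p%:R ^+ logn p `|denq q|%N / p%:R ^+ logn p `|numq q|%N.

Section RatPadicAbs.
Variables (p : nat) (p_pr : prime p).
Local Notation absp := (rat_padic_abs p).

Let p_gt0 : 0 < p%:R :> rat. Proof. by rewrite ltr0n prime_gt0. Qed.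
Let p_neq0 : p%:R != 0 :> rat. Proof. by rewrite gt_eqF. Qed.

Lemma rat_padic_abs0 : absp 0 = 0.
Proof. by rewrite /rat_padic_abs eqxx. Qed.

Lemma rat_padic_abs_ge0 x : 0 <= absp x.
Proof.
by rewrite /rat_padic_abs; case: ifP => // _; rewrite divr_ge0 ?exprn_ge0 ?ltW.
Qed.

Lemma rat_padic_abs_eq0 x : (absp x == 0) = (x == 0).
Proof.
rewrite /rat_padic_abs; case: ifP => [|_]; first by rewrite eqxx.
by rewrite mulf_eq0 invr_eq0 !expf_eq0 (negPf p_neq0) !andbF.
Qed.

Lemma rat_padic_abs_frac (a b : int) : a != 0 -> b != 0 ->
  absp (a%:~R / b%:~R) = p%:R ^+ logn p `|b|%N / p%:R ^+ logn p `|a|%N.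
Proof.
move=> a0 b0; set x := a%:~R / b%:~R.
have x0 : x != 0 by apply: mulf_neq0; rewrite ?invr_eq0 intr_eq0.
have : numq x * b = a * denq x.
  apply/eqP; rewrite -(eqr_int rat) !rmorphM /=.
  by rewrite -eqr_div ?intr_eq0 ?denq_neq0// divq_num_den.
move/(congr1 (logn p \o absz)); rewrite /= !abszM.
rewrite !lognM ?absz_gt0 ?numq_eq0 ?denq_neq0// => e.
rewrite /rat_padic_abs (negPf x0); apply/eqP.
by rewrite eqr_div ?expf_neq0// -!exprD [X in _ == _ ^+ X]addnC e addnC.
Qed.

Lemma rat_padic_absM x y : absp (x * y) = absp x * absp y.
Proof.
have [->|x0] := eqVneq x 0; first by rewrite mul0r rat_padic_abs0 mul0r.
have [->|y0] := eqVneq y 0; first by rewrite mulr0 rat_padic_abs0 mulr0.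
rewrite -{1}[x]divq_num_den -{1}[y]divq_num_den mulf_div -!rmorphM.
rewrite rat_padic_abs_frac ?mulf_neq0 ?numq_eq0 ?denq_neq0//.
rewrite !abszM !lognM ?absz_gt0 ?numq_eq0 ?denq_neq0//.
by rewrite !exprD -mulf_div /rat_padic_abs (negPf x0) (negPf y0).
Qed.

Lemma rat_padic_abs1 : absp 1 = 1.
Proof. by rewrite /rat_padic_abs oner_eq0 (denq_int 1) (numq_int 1) divff ?expf_neq0. Qed.

Lemma rat_padic_absN x : absp (- x) = absp x.
Proof. by rewrite /rat_padic_abs oppr_eq0 denqN numqN abszN. Qed.

Lemma rat_padic_abs_dist x y : absp (x - y) = absp (y - x).
Proof. by rewrite -rat_padic_absN opprB. Qed.

Lemma rat_padic_absV x : absp (x^-1) = (absp x)^-1.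
Proof.
have [->|x0] := eqVneq x 0; first by rewrite invr0 rat_padic_abs0.
have n0 : absp x != 0 by rewrite rat_padic_abs_eq0.
by apply: (mulfI n0); rewrite -rat_padic_absM !divff// rat_padic_abs1.
Qed.

Lemma rat_padic_absD x y : absp (x + y) <= Num.max (absp x) (absp y).
Proof.
have [->|x0] := eqVneq x 0.
  by rewrite add0r rat_padic_abs0 le_max lexx orbT.
have [->|y0] := eqVneq y 0.
  by rewrite addr0 rat_padic_abs0 le_max lexx.
have [->|xy0] := eqVneq (x + y) 0.
  by rewrite rat_padic_abs0 le_max rat_padic_abs_ge0.
pose u := numq x * denq y; pose v := numq y * denq x.
pose w := denq x * denq y.
have w0 : w != 0 by rewrite mulf_neq0 ?denq_neq0.
have u0 : u != 0 by rewrite mulf_neq0 ?numq_eq0 ?denq_neq0.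
have v0 : v != 0 by rewrite mulf_neq0 ?numq_eq0 ?denq_neq0.
have xE : x = u%:~R / w%:~R.
  by rewrite !rmorphM/= -mulf_div divff ?intr_eq0 ?denq_neq0// mulr1 divq_num_den.
have yE : y = v%:~R / w%:~R.
  rewrite /w [denq x * _]mulrC !rmorphM/= -mulf_div.
  by rewrite divff ?intr_eq0 ?denq_neq0// mulr1 divq_num_den.
have xyE : x + y = (u + v)%:~R / w%:~R by rewrite rmorphD mulrDl -xE -yE.
have uv0 : u + v != 0.
  by apply: contraNneq xy0 => e; rewrite xyE e mul0r.
rewrite xyE [in absp x]xE [in absp y]yE !rat_padic_abs_frac//.
rewrite le_max !(ler_pM2l (exprn_gt0 _ p_gt0)).
have pr1 : 1 < p%:R :> rat by rewrite ltr1n prime_gt1.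
have key : (minn (logn p `|u|) (logn p `|v|) <= logn p `|(u + v)%R|)%N.
  rewrite -pfactor_dvdn ?absz_gt0//.
  have dvz k (a : int) : (p ^ k %| `|a|)%N = ((p ^ k)%N%:Z %| a)%Z by [].
  rewrite dvz rpredD//= -?dvz pfactor_dvdn ?absz_gt0 ?geq_minl ?geq_minr//.
rewrite !lef_pV2 ?posrE ?exprn_gt0// !ler_eXn2l//.
by move: key; rewrite geq_min.
Qed.

Lemma rat_padic_absB x y : absp (x - y) <= Num.max (absp x) (absp y).
Proof. by rewrite -[X in Num.max _ X]rat_padic_absN rat_padic_absD. Qed.

Lemma rat_padic_absB_lt x y e : absp x < e -> absp y < e -> absp (x - y) < e.
Proof.
by move=> xe ye; rewrite (le_lt_trans (rat_padic_absB _ _))// gt_max xe.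
Qed.

Lemma rat_padic_absD_lt x y e : absp x < e -> absp y < e -> absp (x + y) < e.
Proof.
by move=> xe ye; rewrite (le_lt_trans (rat_padic_absD _ _))// gt_max xe.
Qed.

Lemma rat_padic_abs_eq x y : absp (x - y) < absp x -> absp y = absp x.
Proof.
move=> xy; apply/eqP; rewrite eq_le; apply/andP; split.
  have {1}-> : y = x - (x - y) by rewrite opprB addrC subrK.
  by rewrite (le_trans (rat_padic_absB _ _))// ge_max lexx ltW.
rewrite leNgt; apply/negP => yx.
have := rat_padic_absD_lt xy yx.
by rewrite subrK ltxx.
Qed.

End RatPadicAbs.

(* Q_p is built as the completion of rat: Cauchy sequences for the p-adic
   absolute value modulo null sequences. *)

Section PadicField.
Variables (p : nat) (p_pr : prime p).
Local Notation absp := (rat_padic_abs p).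

(* The proof of primality is a parameter because the closure properties
   declared as canonical instances below need p to be prime. *)
Definition padic_cauchy_pred & prime p : {pred nat -> rat} :=
  fun x => `[< forall e : rat, 0 < e -> exists N : nat,
    forall i j, (N <= i)%N -> (N <= j)%N -> absp (x i - x j) < e >].

Local Notation cauchy := (padic_cauchy_pred p_pr).

Lemma padic_cauchyP x : reflect
  (forall e : rat, 0 < e -> exists N : nat,
    forall i j, (N <= i)%N -> (N <= j)%N -> absp (x i - x j) < e)
  (x \in cauchy).
Proof. exact: asboolP. Qed.

Lemma padic_cauchy_bounded x : x \in cauchy ->
  exists2 M : rat, 0 < M & forall i, absp (x i) < M.
Proof.
move=> /padic_cauchyP /(_ 1 ltr01)[N xN].
exists (1 + absp (x N) + \sum_(i < N) (absp (x i))).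
  rewrite ltr_wpDr ?ltr_wpDr ?sumr_ge0 ?rat_padic_abs_ge0// => *.
  exact: rat_padic_abs_ge0.
have s0 (P : pred 'I_N) : 0 <= \sum_(j < N | P j) absp (x j).
  by apply: sumr_ge0 => *; exact: rat_padic_abs_ge0.
move=> i; have [Ni|iN] := leqP N i.
  have xi := xN _ _ Ni (leqnn N).
  rewrite -[x i](subrK (x N)) (le_lt_trans (rat_padic_absD p_pr _ _))//.
  rewrite gt_max; apply/andP; split.
    by rewrite (lt_le_trans xi)// -addrA lerDl addr_ge0 ?rat_padic_abs_ge0.
  by rewrite [1 + _]addrC -addrA ltrDl ltr_wpDr.
rewrite (bigD1 (Ordinal iN))//= addrCA ltrDl.
by rewrite ltr_wpDr// ltr_wpDr ?rat_padic_abs_ge0.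
Qed.

Lemma padic_cauchy_subring : subring_closed cauchy.
Proof.
split.
- by apply/padic_cauchyP => e e0; exists 0%N => i j _ _; rewrite subrr rat_padic_abs0.
- move=> x y /padic_cauchyP xc /padic_cauchyP yc; apply/padic_cauchyP => e e0.
  have [N xN] := xc _ e0; have [M yM] := yc _ e0.
  exists (maxn N M) => i j; rewrite !geq_max => /andP[Ni Mi] /andP[Nj Mj].
  have -> : (x - y) i - (x - y) j = (x i - x j) - (y i - y j).
    by rewrite /= !fctE opprD addrACA -opprD.
  by apply: rat_padic_absB_lt; [exact: p_pr|exact: xN|exact: yM].
- move=> x y xc yc; apply/padic_cauchyP => e e0.
  have [A A0 xA] := padic_cauchy_bounded xc.
  have [B B0 yB] := padic_cauchy_bounded yc.
  move/padic_cauchyP: xc => /(_ _ (divr_gt0 e0 B0))[N xN].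
  move/padic_cauchyP: yc => /(_ _ (divr_gt0 e0 A0))[M yM].
  exists (maxn N M) => i j; rewrite !geq_max => /andP[Ni Mi] /andP[Nj Mj].
  have -> : (x * y) i - (x * y) j = x i * (y i - y j) + (x i - x j) * y j.
    by rewrite mulrBr mulrBl addrA subrK.
  apply: rat_padic_absD_lt => //; rewrite rat_padic_absM//.
    rewrite -[ltRHS](mulfVK (lt0r_neq0 A0)) mulrC.
    by apply: ltr_pM; rewrite ?rat_padic_abs_ge0 ?yM.
  rewrite -[ltRHS](mulfVK (lt0r_neq0 B0)).
  by apply: ltr_pM; rewrite ?rat_padic_abs_ge0 ?xN.
Qed.

HB.instance Definition _ := GRing.isSubringClosed.Build (nat -> rat)
  cauchy padic_cauchy_subring.

Record padic_cauchy := PadicCauchy {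
  padic_cauchy_val :> nat -> rat;
  padic_cauchy_valP : padic_cauchy_val \in cauchy
}.

HB.instance Definition _ := [isSub for padic_cauchy_val].
HB.instance Definition _ := [Choice of padic_cauchy by <:].
HB.instance Definition _ := [SubChoice_isSubComNzRing of padic_cauchy by <:].

Definition padic_null : {pred padic_cauchy} :=
  fun x => `[< forall e : rat, 0 < e -> exists N : nat,
    forall i, (N <= i)%N -> absp (x i) < e >].

Lemma padic_nullP (x : padic_cauchy) : reflect
  (forall e : rat, 0 < e -> exists N : nat,
    forall i, (N <= i)%N -> absp (x i) < e)
  (x \in padic_null).
Proof. exact: asboolP. Qed.

Lemma padic_null_idealr : idealr_closed padic_null.
Proof.
split.
- by apply/padic_nullP => e e0; exists 0%N => i _; rewrite rat_padic_abs0.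
- apply/padic_nullP => /(_ 1 ltr01)[N /(_ _ (leqnn N))].
  by rewrite rat_padic_abs1// ltxx.
- move=> a u v /padic_nullP un /padic_nullP vn; apply/padic_nullP => e e0.
  have [A A0 aA] := padic_cauchy_bounded (padic_cauchy_valP a).
  have [N uN] := un _ (divr_gt0 e0 A0); have [M vM] := vn _ e0.
  exists (maxn N M) => i; rewrite geq_max => /andP[Ni Mi].
  apply: (rat_padic_absD_lt p_pr); last exact: vM.
  rewrite [_ i]/(a i * u i) rat_padic_absM// -[ltRHS](mulfVK (lt0r_neq0 A0)).
  by rewrite mulrC; apply: ltr_pM; rewrite ?rat_padic_abs_ge0 ?uN.
Qed.

HB.instance Definition _ := isIdealr.Build padic_cauchy
  padic_null padic_null_idealr.

Definition padic := {ideal_quot padic_null}.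

HB.instance Definition _ := GRing.ComNzRing.on padic.
HB.instance Definition _ := NzRingQuotient.on padic.

Lemma padic_cauchy_abs_eventually (x : padic_cauchy) : x \notin padic_null ->
  exists2 c : rat, 0 < c &
    exists N, forall i, (N <= i)%N -> absp (x i) = c.
Proof.
move=> /padic_nullP/existsNP[e /not_implyP[e0 /forallNP xe]].
have /padic_cauchyP/(_ _ e0)[N xN] := padic_cauchy_valP x.
have /existsNP[k /not_implyP[Nk /negP]] := xe N; rewrite -leNgt => ek.
exists (absp (x k)); first exact: lt_le_trans ek.
exists N => i Ni; apply: (rat_padic_abs_eq p_pr).
exact: lt_le_trans (xN _ _ Nk Ni) ek.
Qed.

Definition padic_inv (x : padic) : padic :=
  if x == 0 then 0
  else \pi_padic (insubd (0 : padic_cauchy) (fun i => (repr x i)^-1)).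

Lemma padic_inv0 : padic_inv 0 = 0.
Proof. by rewrite /padic_inv eqxx. Qed.

Lemma padic_pi_eq0 (x : padic_cauchy) : (\pi_padic x == 0) = (x \in padic_null).
Proof.
by rewrite -[x in RHS]subr0 Quotient.idealrBE (rmorph0 \pi_padic).
Qed.

Lemma padic_mulVf (x : padic) : x != 0 -> padic_inv x * x = 1.
Proof.
move=> x0; rewrite /padic_inv (negPf x0).
have : repr x \notin padic_null by rewrite -padic_pi_eq0 reprK.
move=> /padic_cauchy_abs_eventually[c c0 [N xN]].
have xi0 i : (N <= i)%N -> repr x i != 0.
  by move=> Ni; rewrite -(rat_padic_abs_eq0 p_pr) xN// gt_eqF.
have yc : (fun i => (repr x i)^-1) \in cauchy.
  apply/padic_cauchyP => e e0.
  have /padic_cauchyP/(_ (e * (c * c)))[|M xM] := padic_cauchy_valP (repr x).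
    by rewrite !mulr_gt0.
  exists (maxn N M) => i j; rewrite !geq_max => /andP[Ni Mi] /andP[Nj Mj].
  have -> : (repr x i)^-1 - (repr x j)^-1 =
      (repr x j - repr x i) / (repr x i * repr x j).
    rewrite -[LHS](mulfK (mulf_neq0 (xi0 _ Ni) (xi0 _ Nj))); congr (_ / _).
    by rewrite mulrBl mulKf ?xi0// [X in _ * X]mulrC mulKf ?xi0.
  rewrite rat_padic_absM// rat_padic_absV// rat_padic_absM// !xN//.
  by rewrite ltr_pdivrMr ?mulr_gt0// xM.
rewrite -[X in _ * X = _]reprK -rmorphM -[RHS](rmorph1 \pi_padic).
apply/eqP; rewrite -subr_eq0 -rmorphB padic_pi_eq0; apply/padic_nullP => e e0.
exists N => i Ni; set y := insubd _ _.
have -> : (y * repr x - 1) i = y i * repr x i - 1 by [].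
have -> : y i = (repr x i)^-1 by rewrite -[y i]/(val y i) insubdK.
by rewrite mulVf ?xi0// subrr rat_padic_abs0.
Qed.

HB.instance Definition _ :=
  GRing.ComNzRing_isField.Build padic padic_mulVf padic_inv0.

End PadicField.

(* The extension of rat_padic_abs by continuity; the limit exists and does not
   depend on the representative by padic_abs_cvg below. *)

Definition padic_abs (R : realType) (p : nat) (p_pr : prime p)
    (x : padic p_pr) : R :=
  limn (fun i : nat => ratr (rat_padic_abs p (repr x i)) : R).

Section PadicAbs.
Variables (R : realType) (p : nat) (p_pr : prime p).
Local Notation Qp := (padic p_pr).
Local Notation absp := (rat_padic_abs p).
Implicit Types (x y : Qp) (s t : padic_cauchy p_pr).

Local Open Scope classical_set_scope.

Let null_cvg s : s \in padic_null (p_pr:=p_pr) ->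
  (fun i : nat => ratr (absp (s i)) : R) @ \oo --> (0 : R).
Proof.
move=> /padic_nullP s0; apply/cvgrPdist_lt => e e0.
have [q] := rat_in_itvoo e0; rewrite in_itv/= ltr0q => /andP[q0 qe].
have [N sN] := s0 _ q0.
near=> i; rewrite sub0r normrN ger0_norm ?ler0q ?rat_padic_abs_ge0//.
rewrite (lt_trans _ qe)// ltr_rat sN//.
by near: i; exact: nbhs_infty_ge.
Unshelve. all: end_near. Qed.

Let pi_cvg_repr s : exists l : R,
  (fun i : nat => ratr (absp (s i)) : R) @ \oo --> l /\
  (fun i : nat => ratr (absp (repr (\pi_Qp s) i)) : R) @ \oo --> l.
Proof.
pose t := repr (\pi_Qp s).
have : t - s \in padic_null (p_pr:=p_pr) by rewrite Quotient.idealrBE reprK.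
have [s0|sN0] := boolP (s \in padic_null (p_pr:=p_pr)).
  move=> ts; have t0 : t \in padic_null (p_pr:=p_pr) by rewrite -[t](subrK s) rpredD.
  by exists 0; split; exact: null_cvg.
have [c c0 [N sN]] := padic_cauchy_abs_eventually sN0.
move=> /padic_nullP /(_ _ c0)[M tM].
exists (ratr c); split.
  apply: cvg_near_cst; near=> i; rewrite sN//.
  by near: i; exact: nbhs_infty_ge.
apply: cvg_near_cst; near=> i.
have Ni : (N <= i)%N by near: i; exact: nbhs_infty_ge.
have Mi : (M <= i)%N by near: i; exact: nbhs_infty_ge.
rewrite -(sN _ Ni); congr ratr; apply: (rat_padic_abs_eq p_pr).
by rewrite rat_padic_abs_dist sN//; exact: tM.
Unshelve. all: end_near. Qed.

Lemma padic_abs_cvg s :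
  (fun i : nat => ratr (absp (s i)) : R) @ \oo --> padic_abs R (\pi_Qp s).
Proof.
have [l [sl tl]] := pi_cvg_repr s.
by rewrite /padic_abs (cvg_lim _ tl).
Qed.

Lemma padic_abs_ge0 x : 0 <= padic_abs R x.
Proof.
have c := padic_abs_cvg (s := repr x); rewrite reprK in c.
rewrite -(cvg_lim _ c)//; apply: limr_ge; first exact: cvgP c.
by near=> i; rewrite ler0q rat_padic_abs_ge0.
Unshelve. all: end_near. Qed.

Lemma padic_absM x y : padic_abs R (x * y) = padic_abs R x * padic_abs R y.
Proof.
rewrite -[x]reprK -[y]reprK -rmorphM.
apply: (cvg_unique _ (padic_abs_cvg (s := repr x * repr y))) => //=.
have -> : (fun i : nat => ratr (absp ((repr x * repr y) i)) : R) =
    (fun i => ratr (absp (repr x i)) * ratr (absp (repr y i))).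
  by apply/funext => i; rewrite -rmorphM -rat_padic_absM.
exact: cvgM (padic_abs_cvg (s := repr x)) (padic_abs_cvg (s := repr y)).
Qed.

Lemma padic_absD x y :
  padic_abs R (x + y) <= Num.max (padic_abs R x) (padic_abs R y).
Proof.
rewrite -[x]reprK -[y]reprK -rmorphD.
have cs := padic_abs_cvg (s := repr x + repr y).
have cx := padic_abs_cvg (s := repr x); have cy := padic_abs_cvg (s := repr y).
have := cvgM (cvgD (cvgD cx cy) (cvg_norm (cvgB cx cy))) (cvg_cst (2%:R^-1 : R)).
rewrite -maxr_absE => /(_ _ _ _ _ _ _)-c.
rewrite -(cvg_lim _ cs)// -(cvg_lim _ c)//.
apply: ler_lim; [exact: cvgP cs|exact: cvgP c|apply: nearW => i /=].
have := rat_padic_absD p_pr (repr x i) (repr y i).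
by rewrite -maxr_absE !le_max !ler_rat.
Qed.

Lemma padic_abs_eq0 x : (padic_abs R x == 0) = (x == 0).
Proof.
rewrite -[x]reprK padic_pi_eq0; have c := padic_abs_cvg (s := repr x).
apply/eqP/idP => [c0|x0]; last first.
  by apply: (cvg_unique _ c) => //; exact: null_cvg.
apply: contraPT c0 => /padic_cauchy_abs_eventually[d d0 [N xN]].
suff -> : padic_abs R (\pi_Qp (repr x)) = ratr d.
  by apply/eqP; rewrite gt_eqF// ltr0q.
apply: (cvg_unique _ c) => //; apply: cvg_near_cst; near=> i; rewrite xN//.
by near: i; exact: nbhs_infty_ge.
Unshelve. all: end_near. Qed.

Lemma padic_abs_int (a : int) : padic_abs R (a%:~R : Qp) = ratr (absp a%:~R).
Proof.
rewrite -[_%:~R](rmorph_int \pi_Qp).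
apply: (cvg_unique _ (padic_abs_cvg (s := a%:~R))) => //=.
have -> : (fun i : nat => ratr (absp ((a%:~R : padic_cauchy p_pr) i)) : R) =
    fun=> ratr (absp a%:~R).
  apply/funext => i; rewrite -[padic_cauchy_val _]/(val _) rmorph_int.
  have nE k : (k%:R : nat -> rat) i = k%:R.
    by elim: k => // k IH; rewrite !mulrS -IH.
  by case: a => k; rewrite ?NegzE ?mulrNz -!pmulrn -?nE.
exact: cvg_cst.
Qed.

Lemma padic_abs_ratr (q : rat) : padic_abs R (ratr q : Qp) = ratr (absp q).
Proof.
have d0 : ratr (absp (denq q)%:~R) != 0 :> R.
  by rewrite fmorph_eq0 rat_padic_abs_eq0// intr_eq0 denq_neq0.
have dQp : (denq q)%:~R != 0 :> Qp by rewrite -padic_abs_eq0 padic_abs_int.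
apply: (mulIf d0); rewrite -{1}padic_abs_int -padic_absM {1}/ratr mulfVK//.
by rewrite padic_abs_int -rmorphM -rat_padic_absM// -numqE.
Qed.

End PadicAbs.

Section Exponents.
Variables (R : realType) (p : nat) (p_pr : prime p).
Implicit Types (n : nat) (xi : padic p_pr).

Definition height n (x : 'I_n.+1 -> int) : int :=
  \big[Num.max/0]_(i < n.+1) `|x i|.

Definition poly_value n (x : 'I_n.+1 -> int) xi : R :=
  padic_abs R (\sum_(i < n.+1) (x i)%:~R * xi ^+ i).

Definition simultaneous_value n (x : 'I_n.+1 -> int) xi : R :=
  \big[Num.max/0]_(i < n.+1 | (0 < i)%N)
    padic_abs R ((x ord0)%:~R * xi ^+ i - (x i)%:~R).

Definition w_exponent n xi : \bar R :=
  ereal_sup [set w%:E | w in [set w : R |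
    forall A : R, exists2 X : R, A < X & exists x : 'I_n.+1 -> int,
      0 < poly_value x xi <= X `^ (- w - 1) /\ (height x)%:~R <= X]]%classic.

Definition w_hat n xi : \bar R :=
  ereal_sup [set w%:E | w in [set w : R |
    \forall X \near +oo, exists x : 'I_n.+1 -> int,
      (height x)%:~R <= X /\ 0 < poly_value x xi <= X `^ (- w - 1)]]%classic.

Definition lambda_hat n xi : \bar R :=
  ereal_sup [set l%:E | l in [set l : R |
    \forall X \near +oo, exists x : 'I_n.+1 -> int,
      (height x)%:~R <= X /\
      0 < simultaneous_value x xi <= X `^ (- l - 1)]]%classic.

End Exponents.

(* Main.v *)
Require Import Defs.
From HB Require Import structures.
From mathcomp Require Import all_boot all_order all_algebra.
From mathcomp Require Import all_classical all_reals all_analysis.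
From mathcomp Require Import zify ring lra.

Set Implicit Arguments.
Unset Strict Implicit.
Unset Printing Implicit Defensive.

Import Order.TTheory GRing.Theory Num.Theory.

Local Open Scope ring_scope.

(** Why the theorem holds.

   Write [N = m + n - 1] and suppose that some admissible exponent [l] of
   [lambda_hat] exceeds both reciprocals, so that [w_exponent] and [w_hat]
   both exceed [1/l].  Polynomials over the integers act on integer vectors
   [x] of length [N + 1] by the pairing [<P, x> = sum_i P_i x_i], and
     [<P, x> = x_0 P(xi) - sum_i P_i (x_0 xi^i - x_i)].
   If [P(xi)] and all [x_0 xi^i - x_i] are [p]-adically small, the right-hand
   side is a small [p]-adic number, while the left-hand side is an integer
   bounded by [(N + 1) H(P) H(x)].  A nonzero integer [a] satisfies
   [|a|_p >= 1/|a|], so [<P, x> = 0] as soon as the approximations are good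
   enough ([pairing_eq0]).

   Take [P] of degree at most [m] and large height [h] with
   [|P(xi)|_p <= h^(-w-1)], then [Q] of degree at most [n] and height at most
   a small multiple of [h] with [|Q(xi)|_p << h^(-u-1)], and [x] of height at
   most [h^v], where [1/l < v < min(w, u)].  These inequalities are exactly
   what makes [x] orthogonal to all [P T^i] with [i < n] and to all [Q T^j]
   with [j < m].  When [P] and [Q] are coprime, their resultant is a nonzero
   constant of the form [U P + V Q] with [deg U < n] and [deg V < m], hence
   [x_0 = 0] ([first_coord_eq0_of_coprime]); but then some [x_i] is a nonzero
   integer too small [p]-adically for its size ([first_coord_neq0]).

   Coprimality rests on the fact that heights are multiplicative up to a
   constant depending on the degrees ([height_mul_ge]).  Choose the degree [d]
   of [P] minimal such that degree [d] still allows exponents above [1/l].  A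
   proper factorization [P = A B] would make [A] or [B] a good approximation
   of smaller degree, so a common factor of [P] and [Q] can only be the
   primitive polynomial [P] itself; and [P] divides no nonzero [Q] whose
   height is a small enough multiple of [h]. *)

(** * Heights of integer polynomials *)

Definition poly_height (P : {poly int}) : nat := \max_(i < size P) absz (P`_i)%R.

Lemma coef_le_height (P : {poly int}) i : (absz (P`_i)%R <= poly_height P)%N.
Proof.
have [iP|Pi] := ltnP i (size P); last by rewrite nth_default.
exact: (leq_bigmax (Ordinal iP)).
Qed.

Lemma poly_height_leP (P : {poly int}) (M : nat) :
  reflect (forall i, (absz (P`_i)%R <= M)%N) (poly_height P <= M)%N.
Proof.
apply: (iffP idP) => [PM i|PM]; first exact: leq_trans (coef_le_height P i) PM.
by apply/bigmax_leqP => i _.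
Qed.

Lemma poly_height_gt0 (P : {poly int}) : P != 0 -> (0 < poly_height P)%N.
Proof.
move=> P0; apply: leq_trans (coef_le_height P (size P).-1).
by rewrite absz_gt0 -lead_coefE lead_coef_eq0.
Qed.

Lemma poly_height_scale (c : int) (P : {poly int}) :
  (poly_height (c *: P) = `|c| * poly_height P)%N.
Proof.
have [->|c0] := eqVneq c 0.
  by rewrite scale0r mul0n /poly_height size_poly0 big_ord0.
apply/eqP; rewrite eqn_leq; apply/andP; split.
  by apply/poly_height_leP => i; rewrite coefZ abszM leq_mul2l coef_le_height orbT.
rewrite mulnC -leq_divRL ?absz_gt0//; apply/poly_height_leP => i.
by rewrite leq_divRL ?absz_gt0// mulnC -abszM -coefZ coef_le_height.
Qed.

Lemma poly_height_mulXn (P : {poly int}) k :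
  (poly_height (P * 'X^k) <= poly_height P)%N.
Proof.
apply/poly_height_leP => i; rewrite coefMXn.
by case: ifP => // _; exact: coef_le_height.
Qed.

Lemma horner_height_le d D (P : {poly int}) (t : nat) :
  (size P <= d)%N -> (t <= D)%N ->
  (`|P.[t%:Z]%R|%N <= (\sum_(i < d) D ^ i) * poly_height P)%N.
Proof.
move=> Pd tD; rewrite (horner_coef_wide _ Pd) big_distrl /=.
elim/big_ind2 : _ => //= [a1 b1 a2 b2 h1 h2|i _].
  by apply: leq_trans (leq_add h1 h2); lia.
rewrite abszM mulnC leq_mul ?coef_le_height// abszX /=.
by case: (nat_of_ord i) => // j; rewrite leq_exp2r.
Qed.

(** Interpolation without denominators: dividing [A - A(t)] by [X - t] keeps
   integer coefficients and lowers the degree, and at an integer point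
   [u != t] the quotient is at most [|A(u)| + |A(t)|] because
   [|u - t| >= 1].  The constant depends only on the degree bound and on the
   size of the points. *)
Lemma height_le_eval_max k D : exists2 C, (0 < C)%N &
  forall (s : seq nat) (A : {poly int}), uniq s -> size s = k.+1 ->
    all (leq^~ D) s -> (size A <= k.+1)%N ->
    exists2 t, t \in s & (poly_height A <= C * `|A.[t%:Z]%R|)%N.
Proof.
elim: k => [|k [C C0 IH]].
  exists 1%N => // s A _; case: s => [|t [|]]// _ _ A1.
  exists t; rewrite ?inE// mul1n; have -> := size1_polyC A1.
  rewrite hornerC; apply/poly_height_leP => i.
  by rewrite coefC; case: ifP.
exists (2 * D.+1 * C + 1)%N; first by rewrite addn1.
move=> s A; case: s => [|t s]//= /andP[ts us] [ss] /andP[tD sD] sA.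
pose c := A.[t%:Z].
have /factor_theorem[q qE] : root (A - c%:P) t%:Z by rewrite rootE !hornerE subrr.
have AE : A = q * ('X - (t%:Z)%:P) + c%:P by rewrite -qE subrK.
have sq : (size q <= k.+1)%N.
  have [->|q0] := eqVneq q 0; first by rewrite size_poly0.
  have : (size (A - c%:P)%R <= k.+2)%N.
    rewrite (leq_trans (size_polyD _ _))// geq_max sA size_polyN.
    by rewrite (leq_trans (size_polyC_leq1 _)).
  by rewrite qE size_Mmonic ?monicXsubC// size_XsubC addn2.
have [u us' uH] := IH s q us ss sD sq.
have hA : (poly_height A <= D.+1 * poly_height q + `|c|)%N.
  apply/poly_height_leP => i.
  have -> : A`_i = (if i == 0%N then 0 else q`_i.-1) - q`_i * t%:Z +
      (if i == 0%N then c else 0).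
    by rewrite {1}AE coefD mulrBr coefD coefN coefMX coefMC coefC.
  have q2 := coef_le_height q i.-1.
  have : (absz (q`_i * t%:Z)%R <= poly_height q * D)%N.
    by rewrite abszM leq_mul ?coef_le_height.
  move: (q`_i * t%:Z) => x; rewrite mulSn [(D * _)%N]mulnC.
  move: (poly_height q * D)%N (poly_height q) (q`_i.-1) q2 => y h z q2.
  clear -q2; case: (i == 0%N); lia.
have uq : (`|q.[u%:Z]%R| <= `|A.[u%:Z]%R| + `|c|)%N.
  have ut : u != t by apply: contraNneq ts => <-.
  have : q.[u%:Z] * (u%:Z - t%:Z) = A.[u%:Z] - c by rewrite AE !hornerE/=; ring.
  move/(congr1 absz); rewrite abszM => e.
  have e0 : (0 < `|(u%:Z - t%:Z)%R|)%N by rewrite absz_gt0 subr_eq0 eqz_nat.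
  have : (`|q.[u%:Z]%R| <= `|(A.[u%:Z] - c)%R|)%N by rewrite -e leq_pmulr.
  lia.
have fin : (poly_height A <= D.+1 * C * (`|A.[u%:Z]%R| + `|c|) + `|c|)%N.
  apply: (leq_trans hA); rewrite leq_add2r -mulnA leq_mul2l /=.
  by apply: (leq_trans uH); rewrite leq_mul2l uq orbT.
have [Au|Au] := leqP `|A.[u%:Z]%R| `|c|.
  exists t; first by rewrite inE eqxx.
  rewrite -/c; apply: (leq_trans fin).
  have := leq_mul (leqnn (D.+1 * C)) Au; lia.
exists u; first by rewrite inE us' orbT.
apply: (leq_trans fin).
have := leq_mul (leqnn (D.+1 * C)) (ltnW Au); lia.
Qed.

(** A weak form of Gelfond's lemma.  Among [2d + 1] integer points, at most [d]
   give [A] a value much smaller than its height, for otherwise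
   [height_le_eval_max] would fail on [d + 1] of them; the same holds for
   [B].  At a remaining point both values are large, hence so is the value
   of [A B], which is bounded by a constant times the height of [A B]. *)
Lemma height_mul_ge d : exists2 C, (0 < C)%N &
  forall A B : {poly int}, (size A <= d.+1)%N -> (size B <= d.+1)%N ->
    (poly_height A * poly_height B <= C * poly_height (A * B)%R)%N.
Proof.
have [C C0 CH] := height_le_eval_max d (d + d).
pose K := (\sum_(i < (d + d).+1) (d + d) ^ i)%N.
exists (C * C * K)%N.
  by rewrite !muln_gt0 C0 /K big_ord_recl.
move=> A B sA sB.
pose r := iota 0 (d + d).+1.
(* points at which P is small compared with its height *)
pose bad (P : {poly int}) (t : nat) := (C * `|P.[t%:Z]%R| < poly_height P)%N.
have badle (P : {poly int}) : (size P <= d.+1)%N -> (count (bad P) r <= d)%N.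
  move=> sP; rewrite -size_filter leqNgt; apply/negP => dP.
  pose s := take d.+1 ([seq t <- r | bad P t]).
  have sr : {subset s <= [seq t <- r | bad P t]} by move=> x; exact: mem_take.
  have [| | |t ts] := CH s P _ _ _ sP.
  - by apply: take_uniq; rewrite filter_uniq// iota_uniq.
  - by rewrite size_takel.
  - by apply/allP => x /sr; rewrite mem_filter mem_iota; lia.
  - have := sr _ ts; rewrite mem_filter => /andP[].
    by rewrite /bad ltnNge => /negP.
have : has (predC (predU (bad A) (bad B))) r.
  rewrite has_count -(ltn_add2l (count (predU (bad A) (bad B)) r)) addn0.
  rewrite count_predC size_iota ltnS.
  rewrite -(leq_add2r (count (predI (bad A) (bad B)) r)) count_predUI.
  apply: leq_trans (leq_add (badle _ sA) (badle _ sB)) _; exact: leq_addr.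
case/hasP => t tr /=; rewrite /bad negb_or -!leqNgt => /andP[hA hB].
apply: (leq_trans (leq_mul hA hB)).
have tD : (t <= d + d)%N by move: tr; rewrite mem_iota; lia.
have sAB : (size (A * B)%R <= (d + d).+1)%N.
  by apply: (leq_trans (size_polyMleq _ _)); lia.
have := horner_height_le sAB tD; rewrite -/K hornerM abszM => h.
by rewrite mulnACA -!mulnA !leq_mul2l -?mulnA h !orbT.
Qed.

(** * Integers in the p-adic absolute value *)

Section PadicSize.
Variables (R : realType) (p : nat) (p_pr : prime p).
Implicit Types (x y : padic p_pr) (a : int).

Lemma padic_abs0 : padic_abs R (0 : padic p_pr) = 0.
Proof. by apply/eqP; rewrite padic_abs_eq0. Qed.

Lemma padic_abs_intE a : a != 0 ->
  padic_abs R (a%:~R : padic p_pr) = (p%:R ^+ logn p `|a|%N)^-1.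
Proof.
move=> a0; rewrite padic_abs_int /rat_padic_abs intr_eq0 (negPf a0).
by rewrite numq_int denq_int absz1 logn1 expr0 div1r fmorphV rmorphXn /= ratr_nat.
Qed.

Lemma padic_abs_int_le1 a : padic_abs R (a%:~R : padic p_pr) <= 1.
Proof.
have [->|a0] := eqVneq a 0; first by rewrite padic_abs0 ler01.
rewrite padic_abs_intE// invf_le1 ?exprn_gt0 ?ltr0n ?prime_gt0//.
by rewrite exprn_ege1// ler1n prime_gt0.
Qed.

(** The product formula inequality, the source of every lower bound below. *)
Lemma padic_abs_int_ge a : a != 0 ->
  (`|a|%N%:R)^-1 <= padic_abs R (a%:~R : padic p_pr).
Proof.
move=> a0; rewrite padic_abs_intE// lef_pV2 ?posrE ?exprn_gt0 ?ltr0n ?absz_gt0 ?prime_gt0//.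
by rewrite -natrX ler_nat dvdn_leq ?absz_gt0// pfactor_dvdn// absz_gt0.
Qed.

Lemma padic_absN x : padic_abs R (- x) = padic_abs R x.
Proof.
have := padic_absM R (-1) x; rewrite mulN1r => ->.
have -> : padic_abs R (-1 : padic p_pr) = 1; last by rewrite mul1r.
have -> : (-1 : padic p_pr) = (-1)%:~R by [].
by rewrite padic_abs_intE// abszN absz1 logn1 expr0 invr1.
Qed.

Lemma padic_absX x k : padic_abs R (x ^+ k) = padic_abs R x ^+ k.
Proof.
elim: k => [|k IH]; last by rewrite !exprS padic_absM IH.
by rewrite !expr0 -[1](rmorph1 (intmul 1)) padic_abs_intE// absz1 logn1 expr0 invr1.
Qed.

Lemma padic_abs_sum_le (I : Type) (r : seq I) (P : pred I) (F : I -> padic p_pr)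
    (B : R) : 0 <= B -> (forall i, P i -> padic_abs R (F i) <= B) ->
  padic_abs R (\sum_(i <- r | P i) F i) <= B.
Proof.
move=> B0 FB; elim/big_rec : _ => [|i x Pi xB]; first by rewrite padic_abs0.
by rewrite (le_trans (padic_absD _ _ _))// ge_max FB.
Qed.

End PadicSize.

(** * Real powers *)

Section PowR.
Variable R : realType.
Implicit Types x y r : R.

Lemma le0_ler_powR r x y : r <= 0 -> 0 < x -> x <= y -> y `^ r <= x `^ r.
Proof.
move=> r0 x0 xy; have y0 := lt_le_trans x0 xy.
rewrite -[r]opprK (powRN y (- r)) (powRN x (- r)) lef_pV2 ?posrE ?powR_gt0//.
by apply: ge0_ler_powR; rewrite ?oppr_ge0 ?nnegrE ?(ltW x0) ?(ltW y0).
Qed.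

Lemma powRD_gt0 x r s : 0 < x -> x `^ r * x `^ s = x `^ (r + s).
Proof. by move=> x0; rewrite powRD ?(gt_eqF x0) ?implybT. Qed.

Lemma powR_near_gt r M : 0 < r -> \forall x \near +oo, M < x `^ r.
Proof.
move=> r0; near=> x.
have M0 : 0 < 1 + `|M| by rewrite ltr_pwDl.
have : (1 + `|M|) `^ r^-1 < x by near: x; exact: nbhs_pinfty_gt.
move=> /(gt0_ltr_powR r0); rewrite !nnegrE powR_ge0 => /(_ isT) h.
have x0 : 0 <= x by near: x; exact: nbhs_pinfty_ge.
have := h x0; rewrite -powRrM mulVf ?gt_eqF// powRr1 ?ltW// => /ltW h'.
by apply: lt_le_trans h'; rewrite (le_lt_trans (ler_norm M))// ltrDr.
Unshelve. all: end_near. Qed.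

End PowR.

(** * Values of integer polynomials at xi *)

Definition padic_eval (p : nat) (p_pr : prime p) (xi : padic p_pr)
    (P : {poly int}) :
  padic p_pr := (map_poly (intr : int -> padic p_pr) P).[xi].

Section Eval.
Variables (R : realType) (p : nat) (p_pr : prime p) (xi : padic p_pr).
Implicit Types (P Q : {poly int}).
Local Notation ev := (padic_eval xi).
Local Notation absev P := (padic_abs R (ev P)).

Lemma padic_evalM P Q : ev (P * Q) = ev P * ev Q.
Proof. by rewrite /padic_eval rmorphM hornerM. Qed.

Lemma padic_evalZ c P : ev (c *: P) = c%:~R * ev P.
Proof. by rewrite /padic_eval linearZ hornerZ. Qed.

Lemma padic_eval_wide d P : (size P <= d)%N ->
  ev P = \sum_(i < d) (P`_i)%:~R * xi ^+ i.
Proof.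
move=> Pd; rewrite /padic_eval (horner_coef_wide _ (leq_trans (size_poly _ _) Pd)).
by apply: eq_bigr => i _; rewrite coef_map.
Qed.

Lemma padic_eval_neq0 P : ~ algebraicOver (ratr : rat -> padic p_pr) xi ->
  P != 0 -> ev P != 0.
Proof.
move=> xi_tr P0; apply/eqP => e0; apply: xi_tr.
exists (map_poly intr P).
  by rewrite map_poly_eq0_id0// intr_eq0 lead_coef_eq0.
rewrite /root; apply/eqP; rewrite -[RHS]e0 /padic_eval; congr (_.[_]).
apply/polyP => i; rewrite coef_map_id0 ?coef_map /= ?ratr_int//.
exact: (ratr_int _ 0).
Qed.

(** Only finitely many polynomials have bounded degree and height, so their
   nonzero values stay away from zero.  This forces the heights of better
   and better approximations to tend to infinity. *)
Lemma absev_bounded_below d (A : nat) :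
  (forall P, P != 0 -> ev P != 0) ->
  exists2 e : R, 0 < e & forall P, P != 0 -> (size P <= d.+1)%N ->
    (poly_height P <= A)%N -> e < absev P.
Proof.
move=> ev_neq0; pose T := {ffun 'I_d.+1 -> 'I_(A + A).+1}.
(* coefficients in [-A, A], shifted to be indexed by an ordinal *)
pose F (f : T) : {poly int} := \poly_(i < d.+1) ((f (inord i))%:Z - A%:Z).
pose m := \big[Num.min/1]_(f : T | F f != 0) absev (F f).
have m0 : 0 < m.
  apply/bigmin_gtP; split=> // f /ev_neq0 f0.
  by rewrite lt_def padic_abs_eq0 f0 padic_abs_ge0.
exists (m / 2) => [|P P0 Pd PA]; first by rewrite divr_gt0.
pose f : T := [ffun i : 'I_d.+1 => inord (absz (P`_i + A%:Z)%R)].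
have PE : P = F f.
  apply/polyP => i; rewrite coef_poly; case: ltnP => id; last first.
    by rewrite nth_default// (leq_trans Pd).
  have := leq_trans (coef_le_height P i) PA => PiA; rewrite ffunE (inordK id).
  by rewrite inordK; lia.
have mP : m <= absev P by rewrite PE; apply: bigmin_le_cond; rewrite -PE.
apply: lt_le_trans mP; lra.
Qed.

End Eval.

(** * Integer vectors orthogonal to multiples of a polynomial *)

Section Pairing.
Variables (N : nat) (x : 'I_N.+1 -> int).
Implicit Types P Q U : {poly int}.

Definition pairing P : int := \sum_(i < N.+1) P`_i * x i.

Lemma pairingD P Q : pairing (P + Q) = pairing P + pairing Q.
Proof. by rewrite -big_split; apply: eq_bigr => i _; rewrite coefD mulrDl. Qed.

Lemma pairingZ c P : pairing (c *: P) = c * pairing P.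
Proof. by rewrite big_distrr; apply: eq_bigr => i _; rewrite coefZ /= mulrA. Qed.

Lemma pairing0 : pairing 0 = 0.
Proof. by apply: big1 => i _; rewrite coef0 mul0r. Qed.

Lemma pairingC c : pairing c%:P = c * x ord0.
Proof.
rewrite /pairing big_ord_recl coefC /= big1 ?addr0// => i _.
by rewrite coefC /= mul0r.
Qed.

Lemma pairing_mul_eq0 P U k : (size U <= k)%N ->
  (forall i, (i < k)%N -> pairing (P * 'X^i) = 0) -> pairing (U * P) = 0.
Proof.
move=> Uk Pk.
have -> : U = \poly_(i < k) U`_i.
  apply/polyP => i; rewrite coef_poly; case: ltnP => // ki.
  by rewrite nth_default// (leq_trans Uk).
rewrite poly_def mulr_suml (big_morph pairing pairingD pairing0) big1// => i _.
by rewrite -scalerAl pairingZ mulrC ['X^_ * _]mulrC Pk// mul0r.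
Qed.

(** The resultant is a nonzero constant of the form [U P + V Q] whose cofactors
   satisfy [size U <= n] and [size V <= m]; orthogonality of [x] to this
   constant polynomial reads [resultant * x_0 = 0]. *)
Lemma first_coord_eq0_of_coprime m n P Q : (0 < m)%N -> (0 < n)%N ->
  P != 0 -> Q != 0 -> (size P <= m.+1)%N -> (size Q <= n.+1)%N ->
  coprimep P Q ->
  (forall i, (i < n)%N -> pairing (P * 'X^i) = 0) ->
  (forall j, (j < m)%N -> pairing (Q * 'X^j) = 0) ->
  x ord0 = 0.
Proof.
move=> m0 n0 P0 Q0 sP sQ; rewrite coprimep_def => cPQ kP kQ.
suff [c c0] : exists2 c, c != 0 & pairing c%:P = 0.
  by rewrite pairingC => /eqP; rewrite mulf_eq0 (negPf c0) => /eqP.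
have constant (S : {poly int}) : S != 0 -> (size S <= 1)%N ->
    pairing (S * 'X^0) = 0 -> exists2 c, c != 0 & pairing c%:P = 0.
  rewrite expr0 mulr1 => S0 /size1_polyC SE; rewrite SE => SP.
  by exists S`_0 => //; rewrite -polyC_eq0 -SE.
have [P1|P1] := leqP (size P) 1; first by apply: (constant P) => //; exact: kP.
have [Q1|Q1] := leqP (size Q) 1; first by apply: (constant Q) => //; exact: kQ.
have [[U V] /= [sU sV] UV] := resultant_in_ideal P1 Q1.
exists (resultant P Q); first by rewrite resultant_eq0 (eqP cPQ).
rewrite UV pairingD (@pairing_mul_eq0 P U n)// ?(@pairing_mul_eq0 Q V m)//.
- by rewrite -ltnS (leq_trans sV).
- by rewrite -ltnS (leq_trans sU).
Qed.

End Pairing.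

(** By Gauss's lemma, the primitive part of a common divisor divides both
   polynomials over the integers.  It is thus enough to exclude integer
   factors, and these are what [height_mul_ge] controls. *)
Lemma coprimep_primitive (P Q : {poly int}) : P != 0 -> zprimitive P = P ->
  (forall A B : {poly int}, P = A * B -> (1 < size A < size P)%N -> False) ->
  (forall B : {poly int}, Q = P * B -> False) -> coprimep P Q.
Proof.
move=> P0 Pprim Pirr PQ; rewrite coprimep_def.
have G0 : gcdp P Q != 0 by rewrite gcdp_eq0 negb_and P0.
have [B PE] := dvdpP_int (dvdp_gcdl P Q).
have [C QE] := dvdpP_int (dvdp_gcdr P Q).
have sG := size_zprimitive (gcdp P Q).
rewrite eqn_leq size_poly_gt0 G0 andbT leqNgt; apply/negP => G1.
have [GP|PG] := ltnP (size (gcdp P Q)) (size P).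
  by apply: (Pirr _ _ PE); rewrite sG G1.
have : size (gcdp P Q) == size P by rewrite eqn_leq PG dvdp_leq// dvdp_gcdl.
rewrite (dvdp_size_eqp (dvdp_gcdl P Q)) => /eqp_dvdl GP.
have [D] : {D | Q = zprimitive P * D} by apply: dvdpP_int; rewrite -GP dvdp_gcdr.
by rewrite Pprim => /PQ.
Qed.

(** * Small linear forms in integers vanish *)

Section Annihilation.
Variables (R : realType) (p : nat) (p_pr : prime p) (xi : padic p_pr).
Local Notation ev := (padic_eval xi).
Local Notation absev P := (padic_abs R (ev P)).
Variables (N : nat) (x : 'I_N.+1 -> int) (Y : R).
Hypothesis xY : (height x)%:~R <= Y.
Local Notation sim := (simultaneous_value R x xi).

Lemma coord_le i : (absz (x i))%:R <= Y.
Proof.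
apply: le_trans xY; rewrite -[_%:R]/((absz (x i))%:~R) ler_int abszE.
exact: le_bigmax.
Qed.

(** If [x_0 = 0], the errors of the approximation are the coordinates
   themselves, and a nonzero integer of size at most [Y] has [p]-adic absolute
   value at least [1/Y]. *)
Lemma first_coord_neq0 : Y * sim < 1 -> 0 < sim -> x ord0 != 0.
Proof.
move=> Ysim sim0; apply/eqP => x0.
have [|[i i0 xi0]] := bigmax_gtP _ _ _ _ sim0; first by rewrite ltxx.
rewrite x0 mul0r sub0r padic_absN in xi0.
have xin0 : x i != 0 by apply: contraTneq xi0 => ->; rewrite padic_abs0 ltxx.
have : padic_abs R ((x i)%:~R : padic p_pr) <= sim.
  rewrite -padic_absN -sub0r -(mul0r (xi ^+ i)) -[0](mulr0z 1) -x0.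
  exact: le_bigmax_cond.
move=> h; move: Ysim; rewrite ltNge => /negP; apply.
have xi1 : 0 < (absz (x i))%:R :> R by rewrite ltr0n absz_gt0.
rewrite -(mulfV (lt0r_neq0 xi1)) ler_pM ?invr_ge0 ?ler0n ?coord_le//.
exact: le_trans (padic_abs_int_ge R p_pr xin0) h.
Qed.

(** The two smallness hypotheses make the pairing, whose absolute value is at
   most [(N + 1) H Y], [p]-adically smaller than the inverse of this bound. *)
Lemma pairing_eq0 (P : {poly int}) (H : R) : (size P <= N.+1)%N ->
  (poly_height P)%:R <= H -> N.+1%:R * H * Y * absev P < 1 ->
  N.+1%:R * H * Y * sim < 1 -> pairing x P = 0.
Proof.
move=> sP PH hP hsim; apply/eqP; apply: contraTT hsim => a0.
set K := _ * Y in hP *; rewrite -leNgt.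
have aK : (absz (pairing x P))%:R <= K.
  have -> : (absz (pairing x P))%:R = `|(pairing x P)%:~R : R|.
    by rewrite -intr_norm -abszE.
  rewrite rmorph_sum/= (le_trans (ler_norm_sum _ _ _))//.
  have -> : K = \sum_(i < N.+1) H * Y by rewrite sumr_const card_ord -mulr_natl mulrA.
  apply: ler_sum => i _; rewrite rmorphM normrM -!intr_norm -!abszE.
  rewrite ler_pM ?coord_le// (le_trans _ PH)// ler_nat.
  exact: coef_le_height.
have a1 : 0 < (absz (pairing x P))%:R :> R by rewrite ltr0n absz_gt0.
have K0 : 0 < K by apply: lt_le_trans aK.
have : K^-1 <= padic_abs R ((pairing x P)%:~R : padic p_pr).
  by apply: le_trans (padic_abs_int_ge R p_pr a0); rewrite lef_pV2.
have -> : ((pairing x P)%:~R : padic p_pr) = (x ord0)%:~R * ev P -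
    \sum_(i < N.+1) (P`_i)%:~R * ((x ord0)%:~R * xi ^+ i - (x i)%:~R).
  rewrite (padic_eval_wide _ sP) mulr_sumr -sumrB rmorph_sum/=.
  by apply: eq_bigr => i _; rewrite rmorphM; ring.
have sim0 : 0 <= sim by exact: bigmax_ge_id.
move=> h; have := le_trans h (padic_absD _ _ _); rewrite padic_absN le_max.
case/orP => {}h.
  move: hP; rewrite ltNge => /negP[]; rewrite -ler_pdivrMl// mulr1.
  apply: (le_trans h); rewrite padic_absM ler_piMl ?padic_abs_ge0//.
  exact: padic_abs_int_le1.
rewrite -ler_pdivrMl// mulr1; apply: (le_trans h).
apply: padic_abs_sum_le => // i _.
rewrite padic_absM (le_trans (ler_piMl (padic_abs_ge0 _ _) (padic_abs_int_le1 R p_pr _)))//.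
have [->|i0] := eqVneq i ord0; first by rewrite expr0 mulr1 subrr padic_abs0.
by apply: le_bigmax_cond; rewrite lt0n.
Qed.

(** Multiplication by [X^k] keeps the height, and enlarges the value at [xi] by
   at most [K]; the bound [K] appears because [xi] need not be a [p]-adic
   integer. *)
Lemma pairing_mulXn_eq0 (P : {poly int}) (H K : R) k :
  (forall i, (i <= N)%N -> padic_abs R xi ^+ i <= K) ->
  (size P + k <= N.+1)%N -> P != 0 -> (poly_height P)%:R <= H ->
  N.+1%:R * H * Y * (absev P * K) < 1 ->
  N.+1%:R * H * Y * sim < 1 -> pairing x (P * 'X^k) = 0.
Proof.
move=> xiK sP P0 PH hP hsim.
have H0 : 0 <= H by apply: le_trans PH; rewrite ler0n.
have Y0 : 0 <= Y by apply: le_trans (coord_le ord0); rewrite ler0n.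
apply: (@pairing_eq0 _ H) => //.
- by rewrite size_mulXn// addnC.
- by apply: le_trans PH; rewrite ler_nat poly_height_mulXn.
apply: le_lt_trans hP; rewrite ler_wpM2l ?mulr_ge0 ?ler0n//.
rewrite padic_evalM padic_absM ler_wpM2l ?padic_abs_ge0//.
rewrite /padic_eval map_polyXn hornerXn padic_absX.
by apply: xiK; move: P0; rewrite -size_poly_gt0; lia.
Qed.

End Annihilation.

(** * Polynomials with small values *)

Section Approx.
Variables (R : realType) (p : nat) (p_pr : prime p) (xi : padic p_pr).
Hypothesis ev_neq0 : forall P, P != 0 -> padic_eval xi P != 0.
Local Notation ev := (padic_eval xi).
Local Notation absev P := (padic_abs R (ev P)).
Implicit Types (P Q A B : {poly int}) (w u v l X Y : R) (d m n : nat).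

(** Here [X] bounds the height without being equal to it, as in the definitions
   of the exponents. *)
Definition approx_at d w X := exists P,
  [/\ P != 0, (size P <= d.+1)%N, (poly_height P)%:R <= X &
      absev P <= X `^ (- w - 1)].

Definition approximable d w := forall M : R, exists2 X, M < X & approx_at d w X.

(** Dividing by the content [c] multiplies the value by at most [|c|] while
   dividing the height by [|c|], which is favourable since [w > 0].  The
   primitive part still has value at most [X^(-w)], so its height tends to
   infinity with [X] by [absev_bounded_below]. *)
Lemma approximable_primitive d w : 0 < w -> approximable d w ->
  forall M : R, exists P, [/\ P != 0, zprimitive P = P, (size P <= d.+1)%N,
    M < (poly_height P)%:R & absev P <= (poly_height P)%:R `^ (- w - 1)].
Proof.
move=> w0 aw M.
have [e e0 eP] := absev_bounded_below R d (Num.truncn M).+1 ev_neq0.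
have [M1 [_ hM1]] := powR_near_gt e^-1 w0.
have [X] := aw (Num.max 1 M1); rewrite gt_max => /andP[X1 /hM1 Xe].
have X0 : 0 < X by rewrite (lt_trans ltr01).
case=> P [P0 sP PX evP].
pose c := zcontents P; pose P0' := zprimitive P.
have PE : P = c *: P0' by exact: zpolyEprim.
have nzP0 : P0' != 0 by rewrite zprimitive_eq0.
have c0 : c != 0 by rewrite zcontents_eq0.
pose H := (poly_height P0')%:R : R; pose a := (absz c)%:R : R.
have a1 : 1 <= a by rewrite ler1n absz_gt0.
have a0 : 0 < a by rewrite (lt_le_trans ltr01).
have H1 : 1 <= H by rewrite ler1n poly_height_gt0.
have H0 : 0 < H by rewrite (lt_le_trans ltr01).
have aHX : a * H <= X by rewrite -natrM -poly_height_scale -PE.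
have aX : a <= X by rewrite (le_trans _ aHX)// ler_peMr// ltW.
have evP0 : absev P0' <= a * absev P.
  rewrite PE padic_evalZ padic_absM mulrA ler_peMl ?padic_abs_ge0//.
  by rewrite -ler_pdivrMl// mulr1 padic_abs_int_ge.
exists P0'; split => //.
- exact: zprimitive_id.
- by rewrite size_zprimitive.
- rewrite ltNge; apply/negP => HM.
  have : e < absev P0'.
    apply: eP => //; first by rewrite size_zprimitive.
    by rewrite -(ler_nat R) (le_trans HM)// ltW// truncnS_gt.
  rewrite ltNge => /negP; apply; apply: (le_trans evP0).
  have : a * absev P <= X * X `^ (- w - 1) by rewrite ler_pM ?padic_abs_ge0 ?(ltW a0).
  move/le_trans; apply; rewrite -{1}(powRr1 (ltW X0)) powRD_gt0//.
  have -> : 1 + (- w - 1) = - w by ring.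
  by rewrite powRN -[e]invrK lef_pV2 ?posrE ?invr_gt0 ?powR_gt0// ltW.
- apply: (le_trans evP0).
  have : a * absev P <= a * (a * H) `^ (- w - 1).
    rewrite ler_pM2l// (le_trans evP)// le0_ler_powR ?mulr_gt0//; lra.
  move/le_trans; apply; rewrite powRM ?(ltW a0) ?(ltW H0)// mulrA.
  rewrite -{1}(powRr1 (ltW a0)) powRD_gt0//.
  rewrite ler_piMl ?powR_ge0//.
  have -> : 1 + (- w - 1) = - w by ring.
  by rewrite powRN invf_le1 ?powR_gt0// -(powRr0 a) ler_powR// ltW.
Qed.

(** Applying the failure at the scale [X = C H(P)], which is beyond the
   threshold for every [P], turns it into a lower bound valid for all nonzero
   polynomials. *)
Lemma not_approximableP d v : - 1 <= v -> ~ approximable d v ->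
  exists2 C : R, 1 <= C & forall P, P != 0 -> (size P <= d.+1)%N ->
    (C * (poly_height P)%:R) `^ (- v - 1) < absev P.
Proof.
move=> v1 /existsNP[M /forall2NP hM]; exists (1 + `|M|); first by rewrite lerDl.
move=> P P0 sP; rewrite ltNge; apply/negP => hP.
have H1 : 1 <= (poly_height P)%:R :> R by rewrite ler1n poly_height_gt0.
have [[]|[]] := hM ((1 + `|M|) * (poly_height P)%:R).
  apply: (@lt_le_trans _ _ (1 + `|M|)); first by have := ler_norm M; lra.
  by rewrite ler_peMr// addr_ge0.
exists P; split => //; rewrite ler_peMl ?ler0n// lerDl//.
Qed.

(** Approximation constants multiply along a factorization, up to the constant
   of [height_mul_ge]. *)
Lemma absev_mul_gt (C D v : R) A B : -1 <= v -> 0 < C -> 0 < D ->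
  A != 0 -> B != 0 ->
  (poly_height A)%:R * (poly_height B)%:R <= C * (poly_height (A * B))%:R ->
  (D * (poly_height A)%:R) `^ (- v - 1) < absev A ->
  (D * (poly_height B)%:R) `^ (- v - 1) < absev B ->
  (D * D * C * (poly_height (A * B))%:R) `^ (- v - 1) < absev (A * B).
Proof.
move=> v1 C0 D0 A0 B0; rewrite padic_evalM padic_absM.
set a := (poly_height A)%:R; set b := (poly_height B)%:R; set h := _%:R.
have a0 : 0 < a by rewrite ltr0n poly_height_gt0.
have b0 : 0 < b by rewrite ltr0n poly_height_gt0.
move=> ab hA hB.
apply: (@le_lt_trans _ _ ((D * a) `^ (- v - 1) * (D * b) `^ (- v - 1))).
  rewrite -powRM ?mulr_ge0 ?(ltW D0) ?(ltW a0) ?(ltW b0)//.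
  apply: le0_ler_powR; rewrite ?mulr_gt0//; first by rewrite subr_le0 lerNl.
  have -> : D * a * (D * b) = D * D * (a * b) by ring.
  by rewrite -[D * D * C * h]mulrA ler_wpM2l ?mulr_ge0 ?(ltW D0).
by rewrite ltr_pM ?powR_ge0.
Qed.

End Approx.

(** * The contradiction *)

Section Main.
Variables (R : realType) (p : nat) (p_pr : prime p) (xi : padic p_pr).
Hypothesis ev_neq0 : forall P, P != 0 -> padic_eval xi P != 0.
Local Notation ev := (padic_eval xi).
Local Notation absev P := (padic_abs R (ev P)).
Local Notation approx_at := (approx_at (R:=R) xi).
Local Notation approximable := (approximable (R:=R) xi).
Implicit Types (P Q A B : {poly int}) (w u v l X Y : R) (d m n : nat).

(** Minimality of the degree replaces irreducibility: it is what excludes proper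
   factors of the approximating polynomial. *)
Lemma approximable_minimal m w0 r : approximable m w0 -> r < w0 ->
  exists d, [/\ (d <= m)%N, exists2 w, r < w & approximable d w &
    forall d' w, (d' < d)%N -> r < w -> ~ approximable d' w].
Proof.
move=> aw rw.
pose good d := `[< exists2 w, r < w & approximable d w >].
have ex : exists d, good d by exists m; apply/asboolP; exists w0.
exists (ex_minn ex); case: ex_minnP => d /asboolP hd dmin; split => //.
  by apply: dmin; apply/asboolP; exists w0.
move=> d' w d'd rw' aw'; move: d'd; rewrite ltnNge => /negP; apply.
by apply: dmin; apply/asboolP; exists w.
Qed.

(** The core of the argument, with [w] and [u] exponents for polynomials of
   degree at most [m] and [n] respectively.  The heights of [P], [Q] and [x]
   are [h], at most [X = h / 2c] and at most [Y = h^v]; the four powers of [h]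
   required to be large are the margins in the orthogonality of [x] to [P]
   and [Q], in the smallness of the errors of [x], and in the exclusion of
   proper factors of [P]. *)
Lemma not_uniformly_approximable_vector m n N w u l : (0 < m)%N -> (0 < n)%N ->
  (m + n = N.+1)%N -> 0 < l -> l^-1 < w -> l^-1 < u -> approximable m w ->
  (\forall X \near +oo, approx_at n u X) ->
  ~ (\forall Y \near +oo, exists x : 'I_N.+1 -> int,
       (height x)%:~R <= Y /\ 0 < simultaneous_value R x xi <= Y `^ (- l - 1)).
Proof.
move=> m0 n0 mn l0 lw0 lu aw0 [X0 [_ hX0]] [Y0 [_ hY0]].
have [d [dm [{lw0 aw0}w lw aw] dmin]] := approximable_minimal aw0 lw0.
have il0 : 0 < l^-1 by rewrite invr_gt0.
have [v lv vm] : exists2 v, l^-1 < v & v < Num.min w u.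
  by exists ((l^-1 + Num.min w u) / 2); rewrite ?(midf_lt _).1 ?(midf_lt _).2// lt_min lw.
move: vm; rewrite lt_min => /andP[vw vu].
have v0 : 0 < v by exact: lt_trans lv.
have w0 : 0 < w by exact: lt_trans vw.
have u0 : 0 < u by exact: lt_trans vu.
have [C C0 CH] := height_mul_ge (maxn m n).
pose c := C%:R : R; have c0 : 0 < c by rewrite ltr0n.
(* for d <= 1 there are no proper factors to exclude *)
have [D D1 DH] : exists2 D : R, 1 <= D & forall P, P != 0 -> (size P <= d.-1.+1)%N ->
    (1 < d)%N -> (D * (poly_height P)%:R) `^ (- v - 1) < absev P.
  have [d1|d1] := ltnP 1 d; last by exists 1 => // P _ _; rewrite ltnNge d1.
  have dd : (d.-1 < d)%N by rewrite ltn_predL ltnW.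
  have v1 : -1 <= v by lra.
  have [D D1 DH] := not_approximableP v1 (dmin _ _ dd lv).
  by exists D => // P P0 sP _; exact: DH.
(* the maximum with 1 makes the bound monotone in the exponent *)
have [K K0 xiK] : exists2 K : R, 0 < K &
    forall i, (i <= N)%N -> padic_abs R xi ^+ i <= K.
  have m1 : 1 <= Num.max 1 (padic_abs R xi) by rewrite le_max lexx.
  exists (Num.max 1 (padic_abs R xi) ^+ N) => [|i iN].
    by rewrite exprn_gt0// (lt_le_trans ltr01).
  apply: (@le_trans _ _ (Num.max 1 (padic_abs R xi) ^+ i)).
    by rewrite lerXn2r ?nnegrE ?padic_abs_ge0 ?(le_trans ler01)// le_max lexx orbT.
  exact: ler_weXn2l.
have [M [_ hM]] : \forall h \near +oo, [/\
    [/\ 1 < h, h `^ v > Y0 & h / (2 * c) > X0],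
    N.+1%:R * K < h `^ (w - v), N.+1%:R < h `^ (l * v - 1),
    N.+1%:R * K * (2 * c) `^ u < h `^ (u - v) &
    (D * D * c) `^ (v + 1) < h `^ (w - v)].
  have lv1 : 1 < l * v by rewrite -ltr_pdivrMl// mulr1.
  near=> h; split; [split| | | |]; near: h;
    try by apply: powR_near_gt; rewrite ?subr_gt0.
    exact: nbhs_pinfty_gt.
  apply: filterS (nbhs_pinfty_gt (num_real (X0 * (2 * c)))) => h hX.
  by rewrite ltr_pdivlMr// mulr_gt0.
have [P [P0 Pprim sP MP evP]] := approximable_primitive ev_neq0 w0 aw M.
set h := (poly_height P)%:R in MP evP.
have [[h1 hY hX] hP hsim hQ hfac] := hM _ MP.
have h0 : 0 < h by exact: lt_trans h1.
have [Q [Q0 sQ QX evQ]] := hX0 _ hX.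
have [x [xY /andP[sim0 simY]]] := hY0 _ hY.
set X := h / (2 * c) in QX evQ; set Y := h `^ v in xY simY.
have c1 : 1 <= c by rewrite ler1n.
have Xpos : 0 < X by rewrite divr_gt0 ?mulr_gt0.
have Xh : X <= h by rewrite ler_pdivrMr ?mulr_gt0// ler_peMr ?(ltW h0)// mulr_ege1// ler1n.
have Ypos : 0 < Y by exact: powR_gt0.
have cPQ : coprimep P Q.
  apply: coprimep_primitive => //.
    (* a proper factorization of P contradicts the minimality of d *)
    move=> A B PE /andP[A1 AP].
    have [A0 B0] : A != 0 /\ B != 0.
      by apply/andP; rewrite -negb_or -mulf_eq0 -PE.
    have sAB : (size P = (size A + size B).-1)%N by rewrite PE size_mul.
    have sB0 : (0 < size B)%N by rewrite size_poly_gt0.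
    have [d1 sA sB] : [/\ (1 < d)%N, (size A <= d.-1.+1)%N & (size B <= d.-1.+1)%N].
      by clear -A1 AP sP sAB sB0; split; lia.
    have mm : (d <= maxn m n)%N by rewrite (leq_trans dm)// leq_maxl.
    have ab : (poly_height A)%:R * (poly_height B)%:R <= c * (poly_height (A * B))%:R.
      by rewrite -!natrM ler_nat CH//; clear -d1 sA sB mm; lia.
    have D0 : 0 < D by exact: lt_le_trans D1.
    have v1 : -1 <= v by rewrite (le_trans _ (ltW v0))// lerN10.
    have := absev_mul_gt v1 c0 D0 A0 B0 ab (DH A A0 sA d1) (DH B B0 sB d1).
    rewrite -PE -/h.
    rewrite ltNge => /negP; apply; apply: (le_trans evP).
    rewrite powRM ?mulr_ge0 ?(ltW D0) ?(ltW c0) ?(ltW h0)//.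
    have -> : - w - 1 = (v - w) + (- v - 1) by ring.
    rewrite -powRD_gt0// ler_wpM2r ?powR_ge0//.
    have -> : v - w = - (w - v) by ring.
    have -> : - v - 1 = - (v + 1) by ring.
    by rewrite 2!powRN lef_pV2 ?posrE ?powR_gt0 ?mulr_gt0// ltW.
  (* a nonzero multiple of P has height at least h / c, twice the bound on Q *)
  move=> B QE.
  have B0 : B != 0 by apply: contraNneq Q0 => B0; rewrite QE B0 mulr0.
  have sPQ : (size Q = (size P + size B).-1)%N by rewrite QE size_mul.
  have sP0 : (0 < size P)%N by rewrite size_poly_gt0.
  have hPB : (poly_height P * poly_height B <= C * poly_height (P * B)%R)%N.
    by apply: CH; clear -sPQ sP sP0 sQ dm; lia.
  have : h <= c * X.
    apply: (@le_trans _ _ (c * (poly_height Q)%:R)); last by rewrite ler_pM2l.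
    rewrite -natrM ler_nat QE (leq_trans _ hPB)// leq_pmulr//.
    exact: poly_height_gt0.
  have -> : c * X = h / 2 by rewrite /X; field; rewrite gt_eqF.
  by rewrite ler_pdivlMr// ger_pMr// lern1.
have NY : N.+1%:R * h * Y * simultaneous_value R x xi < 1.
  apply: (@le_lt_trans _ _ (N.+1%:R * h * Y * Y `^ (- l - 1))).
    by rewrite ler_wpM2l// !mulr_ge0 ?(ltW h0) ?(ltW Ypos).
  have -> : N.+1%:R * h * Y * Y `^ (- l - 1) = N.+1%:R * (h `^ (l * v - 1))^-1.
    rewrite -!mulrA; congr (_ * _).
    rewrite -{1}(powRr1 (ltW Ypos)) powRD_gt0// /Y -powRrM.
    rewrite -{1}(powRr1 (ltW h0)) powRD_gt0// -powRN; congr (_ `^ _); ring.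
  by rewrite ltr_pdivrMr ?powR_gt0// mul1r.
have x0 : x ord0 != 0.
  apply: (first_coord_neq0 (xi := xi) xY) => //; apply: le_lt_trans NY.
  rewrite ler_wpM2r ?(ltW sim0)// ler_peMl ?(ltW Ypos)//.
  by rewrite mulr_ege1 ?(ltW h1) ?ler1n.
move/eqP: x0; apply.
apply: (first_coord_eq0_of_coprime m0 n0 P0 Q0 _ sQ cPQ); first by clear -sP dm; lia.
- move=> i ik; apply: (pairing_mulXn_eq0 (H := h) xY xiK) => //; first by clear -ik sP dm mn; lia.
  apply: (@le_lt_trans _ _ (N.+1%:R * h * Y * (h `^ (- w - 1) * K))).
    rewrite ler_wpM2l ?mulr_ge0 ?(ltW h0) ?(ltW Ypos)//.
    by rewrite ler_wpM2r ?(ltW K0).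
  have -> : N.+1%:R * h * Y * (h `^ (- w - 1) * K) = N.+1%:R * K * (h `^ (w - v))^-1.
    have <- : h * Y * h `^ (- w - 1) = (h `^ (w - v))^-1; last by ring.
    by rewrite -{1}(powRr1 (ltW h0)) !powRD_gt0// -powRN; congr (_ `^ _); ring.
  by rewrite ltr_pdivrMr ?powR_gt0// mul1r.
- move=> j jk; apply: (pairing_mulXn_eq0 (H := X) xY xiK) => //; first by clear -jk sQ mn; lia.
    apply: (@le_lt_trans _ _ (N.+1%:R * X * Y * (X `^ (- u - 1) * K))).
      apply: ler_wpM2l; last by rewrite ler_wpM2r ?(ltW K0).
      exact: mulr_ge0 (mulr_ge0 (ler0n _ _) (ltW Xpos)) (ltW Ypos).
    have -> : N.+1%:R * X * Y * (X `^ (- u - 1) * K) =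
        N.+1%:R * K * ((2 * c) `^ u * (h `^ (u - v))^-1).
      have <- : X * X `^ (- u - 1) * Y = (2 * c) `^ u * (h `^ (u - v))^-1.
        rewrite -{1}(powRr1 (ltW Xpos)) powRD_gt0//.
        have -> : 1 + (- u - 1) = - u by ring.
        have cc : 0 < 2 * c by rewrite mulr_gt0.
        rewrite /X (powRM _ (ltW h0)) ?invr_ge0 ?(ltW cc)// -(powR_inv1 (ltW cc)).
        rewrite -powRrM mulN1r opprK -powRN mulrAC powRD_gt0// mulrC.
        by congr (_ * _ `^ _); ring.
      by ring.
    by rewrite mulrA ltr_pdivrMr ?powR_gt0// mul1r.
  apply: le_lt_trans NY; rewrite ler_wpM2r ?(ltW sim0)// ler_wpM2r ?(ltW Ypos)//.
  by rewrite ler_wpM2l.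
Unshelve. all: end_near. Qed.

End Main.

(** * From polynomials to the exponents *)

Section Exponents.
Variables (R : realType) (p : nat) (p_pr : prime p) (xi : padic p_pr).

Lemma approx_at_of_vector n (x : 'I_n.+1 -> int) (w X : R) :
  (height x)%:~R <= X -> 0 < poly_value R x xi <= X `^ (- w - 1) ->
  approx_at xi n w X.
Proof.
move=> xX; pose P : {poly int} := \poly_(i < n.+1) x (inord i).
have Pi (i : 'I_n.+1) : P`_i = x i by rewrite coef_poly ltn_ord inord_val.
have sP : (size P <= n.+1)%N by exact: size_poly.
have -> : poly_value R x xi = padic_abs R (padic_eval xi P).
  rewrite (padic_eval_wide _ sP) /poly_value; congr (padic_abs R _).
  by apply: eq_bigr => i _; rewrite Pi.
move=> /andP[P0 PX]; exists P; split => //.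
  apply: contraTneq P0 => ->.
  by rewrite /padic_eval rmorph0 horner0 padic_abs0 ltxx.
have X0 : 0 <= X by apply: le_trans (coord_le xX ord0); rewrite ler0n.
have : (poly_height P <= Num.truncn X)%N.
  apply/bigmax_leqP => i _; rewrite truncn_ge_nat//.
  by have := coord_le xX (Ordinal (leq_trans (ltn_ord i) sP)); rewrite -Pi.
by rewrite truncn_ge_nat.
Qed.

(** The constant polynomial [p^k] with [p^k <= X < p^(k+1)] has value [p^(-k)],
   which is less than [p / X], hence at most [X^(e-1)] once [X^e > p]. *)
Lemma w_hat_ge0 n : (0 <= w_hat R n xi)%E.
Proof.
apply/lee_addgt0Pr => e e0; rewrite -leeBlDr// sub0e -EFinN.
apply: ereal_sup_ubound; exists (- e) => //=; rewrite opprK.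
near=> X.
have X1 : 1 < X by near: X; exact: nbhs_pinfty_gt.
have pX : p%:R < X `^ e by near: X; exact: powR_near_gt.
have X0 : 0 < X by rewrite (lt_trans ltr01).
have t0 : (0 < Num.truncn X)%N by rewrite truncn_gt0 ltW.
pose k := trunc_log p (Num.truncn X).
have /andP[k1 k2] := trunc_log_bounds (prime_gt1 p_pr) t0.
rewrite truncn_ge_nat ?(ltW X0)// in k1.
pose x (i : 'I_n.+1) : int := if i == ord0 then (p ^ k)%:Z else 0.
have pk0 : (0 < p ^ k)%N by rewrite expn_gt0 prime_gt0.
have pvE : poly_value R x xi = (p%:R ^+ k)^-1.
  rewrite /poly_value big_ord_recl big1 ?addr0 => [|i _]; last by rewrite mul0r.
  rewrite expr0 mulr1 padic_abs_intE ?pfactorK//.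
  by rewrite eqz_nat -lt0n.
exists x; split.
  apply: le_trans k1; rewrite -[_%:R]/((p ^ k)%:Z%:~R) ler_int.
  by apply: bigmax_le => // i _; rewrite /x; case: ifP; rewrite ?normr0.
have p0 : 0 < p%:R :> R by rewrite ltr0n prime_gt0.
rewrite pvE invr_gt0 exprn_gt0//=.
have Xk : X < p%:R ^+ k.+1.
  by rewrite -natrX; apply: lt_le_trans (truncnS_gt X) _; rewrite ler_nat.
rewrite powRB ?(gt_eqF X0) ?implybT// powRr1 ?(ltW X0)// ler_pdivlMr//.
apply: le_trans (ltW pX); rewrite ler_pdivrMl ?exprn_gt0//.
by rewrite -exprSr ltW.
Unshelve. all: end_near. Qed.

Lemma w_hat_le_w_exponent n : (w_hat R n xi <= w_exponent R n xi)%E.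
Proof.
apply: ereal_sup_le => _ [w /= [M [_ hM]] <-]; exists w => //= A.
exists (Num.max A M + 1); first by rewrite ltr_pwDr// le_max lexx.
have [|x [xX vx]] := hM (Num.max A M + 1); last by exists x.
by rewrite ltr_pwDr// le_max lexx orbT.
Qed.

End Exponents.

(** Nonnegativity matters: the inverse of a negative extended real would be
   below every [l > 0]. *)
Lemma inve_lt (R : realType) (s : \bar R) (l : R) : (0 <= s)%E -> (s^-1 < l%:E)%E ->
  0 < l /\ (l^-1%:E < s)%E.
Proof.
case: s => [r||]//=; last first.
  by rewrite invey lte_fin => _ l0; rewrite ltry.
rewrite lee_fin inver => r0; case: eqVneq => // rn0.
rewrite !lte_fin => rl.
have r1 : 0 < r by rewrite lt_def rn0.
have l0 : 0 < l by apply: lt_trans rl; rewrite invr_gt0.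
by split=> //; rewrite -[r]invrK ltf_pV2 ?posrE ?invr_gt0.
Qed.

Theorem theorem2p9 (R : realType) (p : nat) (p_pr : prime p) (m n : nat)
    (hm : (0 < m)%N) (hn : (0 < n)%N) (xi : padic p_pr)
    (hxi : ~ algebraicOver (ratr : rat -> padic p_pr) xi) :
  (lambda_hat R (m + n - 1)%N xi <=
     maxe (w_exponent R m xi)^-1 (w_hat R n xi)^-1)%E.
Proof.
have ev_neq0 P : P != 0 -> padic_eval xi P != 0 by exact: padic_eval_neq0.
apply: ge_ereal_sup => _ [l /= hl <-].
rewrite leNgt; apply/negP; rewrite gt_max => /andP[lw lu].
have [l0 {}lw] := inve_lt (le_trans (w_hat_ge0 _ _ _) (w_hat_le_w_exponent _ _ _)) lw.
have [_ {}lu] := inve_lt (w_hat_ge0 _ _ _) lu.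
have [_ [w /= hw <-]] := ereal_sup_gt lw; rewrite lte_fin => {}lw.
have [_ [u /= hu <-]] := ereal_sup_gt lu; rewrite lte_fin => {}lu.
apply: (not_uniformly_approximable_vector ev_neq0 hm hn _ l0 lw lu _ _ hl).
- by rewrite subn1 prednK// addn_gt0 hm.
- move=> A; have [X AX [x [vx xX]]] := hw A.
  by exists X => //; exact: approx_at_of_vector vx.
- apply: filterS hu => X [x [xX vx]]; exact: approx_at_of_vector vx.
Qed.
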